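(* Let $(M,\phi,\xi,\eta,g)$ be a $(2n+1)$-dimensional Sasakian manifold that is $\phi$-projectively flat and admits a $*$-Conformal $\eta$-Ricci soliton. Then $M$ is an Einstein manifold.
   Context: Conventions. $\chi(M)$ is the space of smooth vector fields on $M$; $\nabla$ is the Levi-Civita connection of $g$; $R(X,Y)Z=\nabla_X\nabla_YZ-\nabla_Y\nabla_XZ-\nabla_{[X,Y]}Z$; $S(Y,Z)=\mathrm{trace}\{X\mapsto R(X,Y)Z\}$ is the Ricci tensor; $Q$ is the Ricci operator, $S(X,Y)=g(QX,Y)$. $M$ is Einstein if $S=c\,g$ for some constant $c$. Sasakian manifold. An almost contact metric structure on a connected $(2n+1)$-dimensional manifold $M$ ($n\ge 1$) consists of a $(1,1)$-tensor field $\phi$, a vector field $\xi$, a 1-form $\eta$ and a Riemannian metric $g$ with $\phi^2X=-X+\eta(X)\xi$, $\eta(\xi)=1$, $\eta\circ\phi=0$, $\phi\xi=0$, $g(\phi X,\phi Y)=g(X,Y)-\eta(X)\eta(Y)$, $g(X,\phi Y)=-g(\phi X,Y)$, $g(X,\xi)=\eta(X)$. It is a contact metric structure if $d\eta(X,Y)=g(X,\phi Y)$, and it is normal if $2d\eta(X,Y)\xi+[\phi,\phi](X,Y)=0$, where $[\phi,\phi](X,Y)=\phi^2[X,Y]+[\phi X,\phi Y]-\phi[\phi X,Y]-\phi[X,\phi Y]$ and $d\eta(X,Y)=\frac12\big(X\eta(Y)-Y\eta(X)-\eta([X,Y])\big)$. A Sasakian manifold is a normal contact metric manifold; with these conventions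 $\nabla_X\xi=-\phi X$. Soliton. The $*$-Ricci tensor is $S^*(X,Y)=\frac12\,\mathrm{trace}\{\phi\circ R(X,\phi Y)\}$. $M$ admits a $*$-Conformal $\eta$-Ricci soliton (with data $\lambda,\mu,p$) if $\mathcal{L}_\xi g+2S^*+\left[2\lambda-\left(p+\frac{2}{2n+1}\right)\right]g+2\mu\,\eta\otimes\eta=0$, where $\mathcal{L}_\xi$ is the Lie derivative along $\xi$, $\lambda,\mu$ are real constants and $p$ is a (smooth) scalar field. The projective curvature tensor of the $(2n+1)$-dimensional manifold $M$ is, in this paper, $P(X,Y)Z=R(X,Y)Z-\frac{1}{2n}[g(Y,Z)QX-g(X,Z)QY]$. $M$ (of dimension greater than $3$) is $\phi$-projectively flat if $\phi^2\big(P(\phi X,\phi Y)\phi Z\big)=0$ for all $X,Y,Z\in\chi(M)$. *)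

(* Defs.v *)
From HB Require Import structures.
From mathcomp Require Import all_boot all_order all_algebra.
From mathcomp Require Import all_classical all_reals all_analysis.
From mathcomp Require Import ring.

Set Implicit Arguments.
Unset Strict Implicit.
Unset Printing Implicit Defensive.

Import Order.TTheory GRing.Theory Num.Theory.
Import numFieldNormedType.Exports.
Local Open Scope classical_set_scope.
Local Open Scope ring_scope.

Section SmoothMaps.
Context {R : realType} {V W : normedModType R}.

Fixpoint Ck_on (k : nat) (U : set V) (f : V -> W)
    : Prop :=
  (forall x, U x -> {for x, continuous f}) /\
  match k with
  | 0 => True
  | k'.+1 => forall v : V,
      (forall x, U x -> derivable f x v) /\ Ck_on k' U ('D_v f)
  end.

Definition smooth_on (U : set V) (f : V -> W) : Prop :=
  forall k, Ck_on k U f.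

End SmoothMaps.

Section SmoothClosure.
Context {R : realType} {V : normedModType R}.
Implicit Types (U : set V) (f g : V -> R).

Lemma Ck_on_continuous k U f : Ck_on k U f ->
  forall x, U x -> {for x, continuous f}.
Proof. by case: k => [|k] []. Qed.

Lemma Ck_onW k U f : Ck_on k.+1 U f -> Ck_on k U f.
Proof.
elim: k f => [f [fc _]|k IH f [fc fd]]; first by split.
split=> // v; have [dv cv] := fd v; split=> //; exact: IH.
Qed.

Lemma Ck_on_eq k U f g : open U -> (forall x, U x -> f x = g x) ->
  Ck_on k U f -> Ck_on k U g.
Proof.
move=> oU; elim: k f g => [|k IH] f g fg.
  move=> [fc _]; split=> // x Ux.
  have nfg : \forall y \near x, f y = g y.
    by apply: filterS (open_nbhs_nbhs (conj oU Ux)) => y /fg.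
  rewrite /prop_for /continuous_at -(fg x Ux).
  apply: cvg_trans (fc x Ux); exact: near_eq_cvg.
move=> [fc fd].
have nfg x : U x -> {near x, f =1 g}.
  by move=> Ux; apply: filterS (open_nbhs_nbhs (conj oU Ux)) => y /fg.
split.
  move=> x Ux; rewrite /prop_for /continuous_at -(fg x Ux).
  apply: cvg_trans (fc x Ux); apply: near_eq_cvg; exact: nfg.
move=> v; have [dv cv] := fd v; split.
  by move=> x Ux; exact: near_eq_derivable (nfg x Ux) (dv x Ux).
apply: IH cv => x Ux; exact: near_eq_derive (nfg x Ux).
Qed.

Lemma Ck_on_cst k U (a : R) : Ck_on k U (cst a).
Proof.
elim: k a => [|k IH] a; split=> //; try by move=> x _; exact: cst_continuous.
move=> v; split=> [x _|]; first exact: derivable_cst.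
have -> : 'D_v (cst a) = cst 0 :> (V -> R) by apply/funext => x; exact: derive_cst.
exact: IH.
Qed.

Lemma Ck_onD k U f g : open U -> Ck_on k U f -> Ck_on k U g ->
  Ck_on k U (f \+ g).
Proof.
move=> oU; elim: k f g => [|k IH] f g [fc fd] [gc gd].
  by split=> // x Ux; apply: continuousD; [exact: fc|exact: gc].
split=> [x Ux|v]; first by apply: continuousD; [exact: fc|exact: gc].
have [df cf] := fd v; have [dg cg] := gd v.
split=> [x Ux|]; first by apply: derivableD; [exact: df|exact: dg].
apply: (Ck_on_eq oU) (IH _ _ cf cg) => x Ux /=.
by rewrite [RHS]deriveD //; [exact: df|exact: dg].
Qed.

Lemma Ck_onM k U f g : open U -> Ck_on k U f -> Ck_on k U g ->
  Ck_on k U (f \* g).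
Proof.
move=> oU; elim: k f g => [|k IH] f g Cf Cg.
  by split=> // x Ux; apply: continuousM; apply: Ck_on_continuous Ux; eassumption.
split=> [x Ux|v].
  by apply: continuousM; apply: Ck_on_continuous Ux; eassumption.
have [_ /(_ v)[df cf]] := Cf; have [_ /(_ v)[dg cg]] := Cg.
split=> [x Ux|]; first by apply: derivableM; [exact: df|exact: dg].
have Cf' := Ck_onW Cf; have Cg' := Ck_onW Cg.
apply: (Ck_on_eq oU) (Ck_onD oU (IH _ _ Cf' cg) (IH _ _ Cg' cf)) => x Ux /=.
by rewrite [RHS]deriveM; [|exact: df|exact: dg].
Qed.

End SmoothClosure.

Record chart (R : realType) (T : topologicalType) (m : nat) := Chart {
  chart_dom : set T;
  chart_img : set 'rV[R]_m;
  chart_fun :> T -> 'rV[R]_m;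
  chart_inv : 'rV[R]_m -> T;
  chart_dom_open : open chart_dom;
  chart_img_open : open chart_img;
  chart_funS : forall x, chart_dom x -> chart_img (chart_fun x);
  chart_invS : forall y, chart_img y -> chart_dom (chart_inv y);
  chart_funK : forall x, chart_dom x -> chart_inv (chart_fun x) = x;
  chart_invK : forall y, chart_img y -> chart_fun (chart_inv y) = y;
  chart_fun_cts : forall x, chart_dom x -> {for x, continuous chart_fun};
  chart_inv_cts : forall y, chart_img y -> {for y, continuous chart_inv}
}.

Record smooth_manifold (R : realType) (m : nat) := SmoothManifold {
  manifold_carrier :> topologicalType;
  atlas : set (chart R manifold_carrier m);
  manifold_hausdorff : hausdorff_space manifold_carrier;
  manifold_countable : @second_countable manifold_carrier;
  atlas_cover : forall x, exists2 c, atlas c & chart_dom c x;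
  atlas_compat : forall c d, atlas c -> atlas d ->
    smooth_on (c @` (chart_dom c `&` chart_dom d)) (d \o chart_inv c)
}.

Section SmoothFunctions.
Context {R : realType} {m : nat}.
Variable M : smooth_manifold R m.

Definition smooth_pred : {pred M -> R} := fun f =>
  `[< forall c, atlas c -> smooth_on (chart_img c) (f \o chart_inv c) >].

Record smooth_fun := SmoothFun {
  smooth_fun_val :> M -> R;
  smooth_funP : smooth_fun_val \in smooth_pred
}.

HB.instance Definition _ := [isSub for smooth_fun_val].
HB.instance Definition _ := [Choice of smooth_fun by <:].

Lemma smooth_cst (a : R) : (cst a : M -> R) \in smooth_pred.
Proof. apply/asboolP => c Ac k; exact: Ck_on_cst. Qed.

Definition cst_fun (a : R) : smooth_fun := SmoothFun (smooth_cst a).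

Lemma smooth_mul (f g : M -> R) :
  f \in smooth_pred -> g \in smooth_pred -> f * g \in smooth_pred.
Proof.
move=> /asboolP sf /asboolP sg; apply/asboolP => c Ac k.
exact: (Ck_onM (@chart_img_open _ _ _ c) (sf c Ac k) (sg c Ac k)).
Qed.

Lemma smooth_add (f g : M -> R) :
  f \in smooth_pred -> g \in smooth_pred -> f + g \in smooth_pred.
Proof.
move=> /asboolP sf /asboolP sg; apply/asboolP => c Ac k.
exact: (Ck_onD (@chart_img_open _ _ _ c) (sf c Ac k) (sg c Ac k)).
Qed.

Lemma smooth_scale (a : R) (f : M -> R) :
  f \in smooth_pred -> a *: f \in smooth_pred.
Proof. exact: (smooth_mul (smooth_cst a)). Qed.

Lemma smooth_subring : subring_closed smooth_pred.
Proof.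
split; [exact: smooth_cst | | exact: smooth_mul] => f g sf sg.
by apply: smooth_add => //; rewrite -scaleN1r; exact: smooth_scale.
Qed.

HB.instance Definition _ :=
  GRing.SubChoice_isSubComPzRing.Build _ _ smooth_fun smooth_subring.

Lemma smooth_submod : submod_closed smooth_pred.
Proof.
split; first exact: (smooth_cst 0).
by move=> a f g sf sg; apply: smooth_add => //; exact: smooth_scale.
Qed.

HB.instance Definition _ :=
  GRing.SubZmodule_isSubLmodule.Build R _ _ smooth_fun smooth_submod.

Lemma smooth_funD (f g : smooth_fun) x : (f + g) x = f x + g x.
Proof. by []. Qed.

Lemma smooth_funN (f : smooth_fun) x : (- f) x = - f x.
Proof. by []. Qed.

Lemma smooth_funM (f g : smooth_fun) x : (f * g) x = f x * g x.
Proof. by []. Qed.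

Lemma smooth_funZ a (f : smooth_fun) x : (a *: f) x = a * f x.
Proof. by []. Qed.

Lemma smooth_fun1 x : (1 : smooth_fun) x = 1.
Proof. by []. Qed.

Definition smooth_funE :=
  (smooth_funD, smooth_funN, smooth_funM, smooth_funZ, smooth_fun1).

End SmoothFunctions.

Notation "'C^oo' ( M )" := (smooth_fun M) (at level 8, format "'C^oo' ( M )").

Section VectorFields.
Context {R : realType} {m : nat}.
Variable M : smooth_manifold R m.

Definition tangent_vector (x : M) (v : C^oo(M) -> R) : Prop :=
  (forall (a : R) f g, v (a *: f + g) = a * v f + v g) /\
  (forall f g, v (f * g) = v f * g x + f x * v g).

(* A vector field is a family of tangent vectors X_x, given by X_x f = X f x; it
   is smooth because X maps smooth functions to smooth functions. *)
Definition vfield_pred : {pred C^oo(M) -> C^oo(M)} := fun X =>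
  `[< forall x, tangent_vector x (fun f => X f x) >].

Record vfield := VField {
  vfield_val :> C^oo(M) -> C^oo(M);
  vfieldP : vfield_val \in vfield_pred
}.

HB.instance Definition _ := [isSub for vfield_val].
HB.instance Definition _ := [Choice of vfield by <:].

Lemma vfield_zmod : zmod_closed vfield_pred.
Proof.
split; first by apply/asboolP => x; split=> [a f g|f g] /=; rewrite ?mulr0 ?mul0r addr0.
move=> X Y /asboolP tX /asboolP tY; apply/asboolP => x.
have [lX mX] := tX x; have [lY mY] := tY x.
have sE h : (X - Y) h x = X h x - Y h x by [].
by split=> [a f g|f g]; rewrite !sE ?lX ?lY ?mX ?mY; ring.
Qed.

HB.instance Definition _ :=
  GRing.SubChoice_isSubZmodule.Build _ _ vfield vfield_zmod.

Lemma vfield_scale_subproof (f : C^oo(M)) (X : vfield) :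
  (fun h => f * X h) \in vfield_pred.
Proof.
apply/asboolP => x; have /asboolP/(_ x)[lX mX] := vfieldP X.
by split=> [a h k|h k]; rewrite !smooth_funM ?lX ?mX; ring.
Qed.

Definition vfield_scale (f : C^oo(M)) (X : vfield) : vfield :=
  VField (vfield_scale_subproof f X).

Lemma vfield_scaleA f g X :
  vfield_scale f (vfield_scale g X) = vfield_scale (f * g) X.
Proof. by apply/val_inj/funext => h /=; rewrite mulrA. Qed.

Lemma vfield_scale1 : left_id 1 vfield_scale.
Proof. by move=> X; apply/val_inj/funext => h /=; rewrite mul1r. Qed.

Lemma vfield_scaleDr : right_distributive vfield_scale +%R.
Proof. by move=> f X Y; apply/val_inj/funext => h /=; rewrite mulrDr. Qed.

Lemma vfield_scaleDl X : {morph vfield_scale^~ X : f g / f + g}.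
Proof. by move=> f g; apply/val_inj/funext => h /=; rewrite mulrDl. Qed.

HB.instance Definition _ := GRing.Zmodule_isLmodule.Build C^oo(M) vfield
  vfield_scaleA vfield_scale1 vfield_scaleDr vfield_scaleDl.

Lemma vfieldD (X : vfield) f g : X (f + g) = X f + X g.
Proof.
apply/val_inj/funext => x; have /asboolP/(_ x)[lX _] := vfieldP X.
by have := lX 1 f g; rewrite scale1r mul1r.
Qed.

Lemma vfield0 (X : vfield) : X 0 = 0.
Proof. by apply: (addrI (X 0)); rewrite -vfieldD !addr0. Qed.

Lemma vfieldZ (X : vfield) (a : R) f : X (a *: f) = a *: X f.
Proof.
apply/val_inj/funext => x; have /asboolP/(_ x)[lX _] := vfieldP X.
by have := lX a f 0; rewrite vfield0 !addr0.
Qed.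

Lemma vfieldM (X : vfield) f g : X (f * g) = X f * g + f * X g.
Proof.
apply/val_inj/funext => x; have /asboolP/(_ x)[_ mX] := vfieldP X.
exact: mX.
Qed.

Lemma lie_bracket_subproof (X Y : vfield) :
  (fun f => X (Y f) - Y (X f)) \in vfield_pred.
Proof.
apply/asboolP => x; split=> [a f g|f g].
  by rewrite !(vfieldD, vfieldZ) !smooth_funE; ring.
by rewrite !(vfieldD, vfieldM) !smooth_funE; ring.
Qed.

Definition lie_bracket (X Y : vfield) : vfield :=
  VField (lie_bracket_subproof X Y).

End VectorFields.

Notation "'X^oo' ( M )" := (vfield M) (at level 8, format "'X^oo' ( M )").

Section RiemannianGeometry.
Context {R : realType} {m : nat}.
Variable M : smooth_manifold R m.
Implicit Types (x : M) (X Y Z V W : X^oo(M)) (f : C^oo(M)).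

Definition tangent_basis x (E : 'I_m -> X^oo(M)) : Prop :=
  forall v, tangent_vector x v ->
    exists! c : 'rV[R]_m, forall f, v f = \sum_i c 0 i * E i f x.

(* A C^oo(M)-linear operator A on vector fields restricts to an endomorphism of
   each tangent space; [a] is its matrix in the basis given by the E_i at x. *)
Definition has_trace_at (A : X^oo(M) -> X^oo(M)) x (t : R) : Prop :=
  exists (E : 'I_m -> X^oo(M)) (a : 'M[R]_m),
    [/\ tangent_basis x E,
        forall j f, A (E j) f x = \sum_i a i j * E i f x
      & t = \tr a].

(* Meaningful for C^oo(M)-linear A only. *)
Definition trace_field (A : X^oo(M) -> X^oo(M)) : M -> R :=
  fun x => xget 0 [set t | has_trace_at A x t].

(* X is non-zero at x when X f x != 0 for some f. *)
Record riemannian_metric (g : X^oo(M) -> X^oo(M) -> C^oo(M)) : Prop := {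
  metric_linear : forall f X Y Z, g (f *: X + Y) Z = f * g X Z + g Y Z;
  metric_sym : forall X Y, g X Y = g Y X;
  metric_pos : forall X x, (exists f, X f x != 0) -> 0 < g X X x
}.

Record levi_civita (g : X^oo(M) -> X^oo(M) -> C^oo(M))
    (nabla : X^oo(M) -> X^oo(M) -> X^oo(M)) : Prop := {
  nabla_linear : forall f X Y Z,
    nabla (f *: X + Y) Z = f *: nabla X Z + nabla Y Z;
  nablaD : forall X Y Z, nabla X (Y + Z) = nabla X Y + nabla X Z;
  nabla_leibniz : forall f X Y, nabla X (f *: Y) = X f *: Y + f *: nabla X Y;
  nabla_torsion_free : forall X Y, nabla X Y - nabla Y X = lie_bracket X Y;
  nabla_metric : forall X Y Z, X (g Y Z) = g (nabla X Y) Z + g Y (nabla X Z)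
}.

Definition curvature (nabla : X^oo(M) -> X^oo(M) -> X^oo(M)) X Y Z : X^oo(M) :=
  nabla X (nabla Y Z) - nabla Y (nabla X Z) - nabla (lie_bracket X Y) Z.

Definition ricci (nabla : X^oo(M) -> X^oo(M) -> X^oo(M)) Y Z : M -> R :=
  trace_field (fun X => curvature nabla X Y Z).

Definition ricci_operator (g : X^oo(M) -> X^oo(M) -> C^oo(M))
    (nabla : X^oo(M) -> X^oo(M) -> X^oo(M)) (Q : X^oo(M) -> X^oo(M)) : Prop :=
  forall X Y x, ricci nabla X Y x = g (Q X) Y x.

Definition einstein (g : X^oo(M) -> X^oo(M) -> C^oo(M))
    (nabla : X^oo(M) -> X^oo(M) -> X^oo(M)) : Prop :=
  exists c : R, forall X Y x, ricci nabla X Y x = c * g X Y x.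

Definition lie_derivative_metric V (g : X^oo(M) -> X^oo(M) -> C^oo(M)) X Y :
    C^oo(M) :=
  V (g X Y) - g (lie_bracket V X) Y - g X (lie_bracket V Y).

(* normalised with the factor 1/2, so that d eta = g(., phi .) is consistent
   with nabla xi = - phi *)
Definition ext_derivative (eta : {scalar X^oo(M)}) X Y : C^oo(M) :=
  2^-1 *: (X (eta Y) - Y (eta X) - eta (lie_bracket X Y)).

End RiemannianGeometry.

Section ContactGeometry.
Context {R : realType} {n : nat} {M : smooth_manifold R (2 * n).+1}.
Variables (phi : {linear X^oo(M) -> X^oo(M)}) (xi : X^oo(M)).
Variables (eta : {scalar X^oo(M)}) (g : X^oo(M) -> X^oo(M) -> C^oo(M)).
Variable nabla : X^oo(M) -> X^oo(M) -> X^oo(M).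
Implicit Types X Y Z : X^oo(M).

Record almost_contact_metric : Prop := {
  acm_metric : riemannian_metric g;
  acm_phi2 : forall X, phi (phi X) = - X + eta X *: xi;
  acm_eta_xi : eta xi = 1;
  acm_eta_phi : forall X, eta (phi X) = 0;
  acm_phi_xi : phi xi = 0;
  acm_compat : forall X Y, g (phi X) (phi Y) = g X Y - eta X * eta Y;
  acm_skew : forall X Y, g X (phi Y) = - g (phi X) Y;
  acm_dual : forall X, g X xi = eta X
}.

Definition contact_metric : Prop :=
  almost_contact_metric /\
  forall X Y, ext_derivative eta X Y = g X (phi Y).

Definition nijenhuis X Y : X^oo(M) :=
  phi (phi (lie_bracket X Y)) + lie_bracket (phi X) (phi Y)
  - phi (lie_bracket (phi X) Y) - phi (lie_bracket X (phi Y)).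

Definition normal_structure : Prop :=
  forall X Y, (ext_derivative eta X Y *+ 2) *: xi + nijenhuis X Y = 0.

Definition sasakian : Prop :=
  [/\ (1 <= n)%N, connected [set: M], contact_metric & normal_structure].

Definition star_ricci X Y : M -> R := fun x =>
  2^-1 * trace_field (fun Z => phi (curvature nabla X (phi Y) Z)) x.

Definition star_conformal_eta_ricci_soliton (lambda mu : R) (p : C^oo(M)) :
    Prop :=
  forall X Y x,
    lie_derivative_metric xi g X Y x + 2 * star_ricci X Y x
    + (2 * lambda - (p x + 2 / (2 * n + 1)%:R)) * g X Y x
    + 2 * mu * (eta X x * eta Y x) = 0.

Definition projective_curvature (Q : X^oo(M) -> X^oo(M)) X Y Z : X^oo(M) :=
  curvature nabla X Y Z
  - cst_fun M (2 * n)%:R^-1 *: (g Y Z *: Q X - g X Z *: Q Y).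

Definition phi_projectively_flat (Q : X^oo(M) -> X^oo(M)) : Prop :=
  (3 < (2 * n).+1)%N /\
  forall X Y Z,
    phi (phi (projective_curvature Q (phi X) (phi Y) (phi Z))) = 0.

End ContactGeometry.

(* Main.v *)
Require Import Defs.
From HB Require Import structures.
From mathcomp Require Import all_boot all_order all_algebra.
From mathcomp Require Import all_classical all_reals all_analysis.
From mathcomp Require Import ring lra.

Set Implicit Arguments.
Unset Strict Implicit.
Unset Printing Implicit Defensive.

Import Order.TTheory GRing.Theory Num.Theory.
Import numFieldNormedType.Exports.
Local Open Scope classical_set_scope.
Local Open Scope ring_scope.

(* In a Sasakian manifold R(X, Y)xi = eta(Y)X - eta(X)Y, so S(X, xi) = 2n eta(X).
   phi-projective flatness expresses R(X, phi Y)phi Z through g and Q; taking the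
   trace over X gives S = k g on ker eta at each point, and tracing Q once more
   forces k = 2n, hence S = 2n g.

   Traces are taken at a point x by means of global vector fields, which requires
   C^oo(M)-linear operators to be local. Instead of bump functions we use the
   function u = g(QX, Y) = S(X, Y): by the convention on traces it vanishes
   wherever the tangent space has no basis of global vector fields, so locality
   holds at x as soon as S(X, Y)(x) is non-zero for some X and Y. Consequently
   S(xi, xi) takes only the values 0 and 2n; M being connected, either S = 2n g
   or S = 0. *)

(** * Evaluation at a point, tangent bases and locality of linear forms *)

Section Evaluation.
Context {R : realType} {m : nat} {M : smooth_manifold R m}.
Implicit Types (x : M) (f : C^oo(M)) (X Y : X^oo(M)).

Lemma smooth_fun_ext f f' : (forall x, f x = f' x) -> f = f'.
Proof. by move=> ff'; apply/val_inj/funext => x; exact: ff'. Qed.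

Lemma vfield_ext X Y : (forall f x, X f x = Y f x) -> X = Y.
Proof. by move=> XY; apply/val_inj/funext => f; apply: smooth_fun_ext => x; exact: XY. Qed.

Lemma smooth_fun_continuous f : continuous (f : M -> R).
Proof.
move=> x; have [c Ac xc] := atlas_cover x.
have /asboolP/(_ c Ac 0)[fc _] := smooth_funP f.
have := fc _ (chart_funS xc); rewrite /prop_for => fcx.
have ccx := chart_fun_cts xc; rewrite /prop_for in ccx.
have := continuous_comp ccx fcx.
rewrite /prop_for /continuous_at /= (chart_funK xc); apply: cvg_trans.
apply: near_eq_cvg.
apply: filterS (open_nbhs_nbhs (conj (@chart_dom_open _ _ _ c) xc)) => y yc /=.
by rewrite (chart_funK yc).
Qed.

Lemma smooth_fun0 x : (0 : C^oo(M)) x = 0. Proof. by []. Qed.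

Definition evalf x f : R := f x.

Fact evalf_zmod x : zmod_morphism (evalf x).
Proof. by []. Qed.
Fact evalf_monoid x : monoid_morphism (evalf x).
Proof. by []. Qed.
HB.instance Definition _ x :=
  GRing.isZmodMorphism.Build C^oo(M) R (evalf x) (evalf_zmod x).
HB.instance Definition _ x :=
  GRing.isMonoidMorphism.Build C^oo(M) R (evalf x) (evalf_monoid x).

Lemma smooth_fun_sum (I : finType) (F : I -> C^oo(M)) x :
  (\sum_i F i) x = \sum_i F i x.
Proof. exact: (raddf_sum (evalf x)). Qed.

Definition applyv f X : C^oo(M) := X f.
Fact applyv_scalar f : scalar (applyv f).
Proof. by []. Qed.
HB.instance Definition _ f :=
  GRing.isLinear.Build C^oo(M) X^oo(M) C^oo(M) *%R (applyv f) (applyv_scalar f).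

Lemma vfield_sum (I : finType) (F : I -> X^oo(M)) f :
  (\sum_i F i) f = \sum_i F i f.
Proof. exact: (raddf_sum (applyv f)). Qed.

Definition vanishes x X : Prop := forall f, X f x = 0.

Lemma vfield_tangent x X : tangent_vector x (fun f => X f x).
Proof. by have /asboolP := vfieldP X. Qed.

Definition has_basis x : Prop := exists E : 'I_m -> X^oo(M), tangent_basis x E.

Lemma tangent_basis_coord x E : @tangent_basis R m M x E ->
  exists co : X^oo(M) -> 'rV[R]_m,
    forall X f, X f x = \sum_i co X 0 i * E i f x.
Proof.
move=> bE; have H X : exists c : 'rV[R]_m, forall f, X f x = \sum_i c 0 i * E i f x.
  by have [c [cP _]] := bE _ (vfield_tangent x X); exists c.
by have [co coP] := choice H; exists co.
Qed.

Lemma tangent_basis_free x E (c : 'rV[R]_m) : @tangent_basis R m M x E ->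
  (forall f, \sum_i c 0 i * E i f x = 0) -> c = 0.
Proof.
move=> bE c0; have [c' [_ c'U]] := bE _ (vfield_tangent x 0).
rewrite -(c'U c); last by move=> f; rewrite c0.
by apply: c'U => f; rewrite big1 // => i _; rewrite mxE mul0r.
Qed.

Lemma tangent_basis_inj x E (c c' : 'rV[R]_m) : @tangent_basis R m M x E ->
  (forall f, \sum_i c 0 i * E i f x = \sum_i c' 0 i * E i f x) -> c = c'.
Proof.
move=> bE cc'; apply/eqP; rewrite -subr_eq0; apply/eqP; apply: (tangent_basis_free bE) => f.
under eq_bigr do rewrite !mxE mulrBl.
by rewrite sumrB cc' subrr.
Qed.

(** Induction on [k]: while [k < m], some [c != 0] is annihilated by the rows already built, and
    freeness of the basis yields [f] on which the combination with coefficients [c] is non-zero, so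
    the row of [f] is independent of the others. *)
Lemma dual_functions x E : @tangent_basis R m M x E ->
  exists F : 'I_m -> C^oo(M), \matrix_(i, j) E i (F j) x \in unitmx.
Proof.
move=> bE.
suff H k : (k <= m)%N -> exists F : 'I_k -> C^oo(M),
    row_free (\matrix_(j < k, i < m) E i (F j) x).
  have [F] := H m (leqnn m); rewrite row_free_unit => uF; exists F.
  by rewrite -unitmx_tr (_ : _^T = \matrix_(j, i) E i (F j) x) //;
    apply/matrixP => i j; rewrite !mxE.
elim: k => [_|k IH km].
  by exists (fun _ => 0); rewrite /row_free -leqn0 rank_leq_row.
have [F rF] := IH (ltnW km); set A := \matrix_(j < k, i < m) _ in rF.
have : kermx A^T != 0.
  by rewrite kermx_eq0 /row_free mxrank_tr (eqP rF) neq_ltn km.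
case/rowV0Pn => c /sub_kermxP cA c0.
have [f fP] : exists f, \sum_i c 0 i * E i f x != 0.
  apply: contrapT => nf; move/eqP: c0; apply; apply: (tangent_basis_free bE) => f.
  by apply/eqP; apply: contrapT => /negP fn; apply: nf; exists f.
pose v : 'rV[R]_m := \row_i E i f x.
exists (fun j : 'I_k.+1 => if unlift ord0 j is Some j' then F j' else f).
have -> : (\matrix_(j < k.+1, i < m)
    E i (if unlift ord0 j is Some j' then F j' else f) x) = col_mx v A :> 'M[R]_(1 + k, m).
  apply/matrixP => j i; rewrite !mxE; case: splitP => l /= jl; rewrite !mxE.
    by rewrite (_ : j = ord0) ?unlift_none //; apply: val_inj; rewrite /= jl (ord1 l).
  by rewrite (_ : j = lift ord0 l) ?liftK //; apply: val_inj.
rewrite -[row_free _]/(\rank (col_mx v A) == (1 + k)%N) -addsmxE.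
have vA : v *m c^T != 0.
  apply: contra fP => /eqP/matrixP/(_ 0 0); rewrite !mxE => e.
  by apply/eqP; rewrite -[RHS]e; apply: eq_bigr => i _; rewrite !mxE mulrC.
have dis : (v :&: A)%MS = 0.
  apply/eqP/rowV0P => w; rewrite sub_capmx => /andP[/sub_rVP[a ->] /submxP[D avD]].
  have : (a *: v) *m c^T = 0.
    by rewrite avD -mulmxA -[A]trmxK -trmx_mul cA trmx0 mulmx0.
  rewrite -scalemxAl => /eqP; rewrite scalemx_eq0 (negbTE vA) orbF => /eqP ->.
  by rewrite scale0r.
rewrite mxrank_disjoint_sum // (eqP rF) rank_rV.
by rewrite (_ : v != 0 = true) //; apply/eqP => v0; rewrite v0 mul0mx eqxx in vA.
Qed.

(* [u] replaces a bump function: where the tangent space could fail to be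
   [m]-dimensional it vanishes. *)
Definition local_at x : Prop :=
  has_basis x /\ exists2 u : C^oo(M), u x != 0 & forall y, u y != 0 -> has_basis y.

(** Cramer's rule over [C^oo(M)]: [Y] kills every [F j], hence vanishes wherever [u] and [d] do not,
    so [(u * d) *: Y] is zero globally and linearity applies. At [x], [u] and [d] are non-zero while
    the coefficients [k] vanish with [X]. *)
Lemma scalar_local x (theta : X^oo(M) -> C^oo(M)) X :
  local_at x -> scalar theta -> vanishes x X -> theta X x = 0.
Proof.
move=> [[E bE] [u ux uB]] lin X0.
pose th : {scalar X^oo(M)} := HB.pack theta
  (GRing.isLinear.Build C^oo(M) X^oo(M) C^oo(M) *%R theta lin).
have [F uF] := dual_functions bE.
pose G : 'M[C^oo(M)]_m := \matrix_(i, j) E i (F j).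
pose h : 'rV[C^oo(M)]_m := \row_j X (F j).
pose k := h *m \adj G; pose d := \det G.
pose Y := d *: X - \sum_i k 0 i *: E i.
have dE y : d y = \det (\matrix_(i, j) E i (F j) y).
  rewrite -[d y]/(evalf y (\det G)) -det_map_mx; congr (\det _).
  by apply/matrixP => i j; rewrite !mxE.
have YF j : Y (F j) = 0.
  apply/eqP; rewrite -[Y _]/(d * X (F j) - (\sum_i k 0 i *: E i) (F j)) vfield_sum.
  rewrite subr_eq0; apply/eqP.
  transitivity ((h *m (\adj G *m G)) 0 j).
    by rewrite mul_adj_mx mul_mx_scalar !mxE.
  by rewrite mulmxA mxE; apply: eq_bigr => i _; rewrite [G _ _]mxE.
have Y0 : (u * d) *: Y = 0.
  apply: vfield_ext => f y; rewrite -[LHS]/(u y * d y * Y f y) -[RHS]/(0 : R).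
  have [->|dy] := eqVneq (d y) 0; first by rewrite mulr0 mul0r.
  have [->|/uB[B bB]] := eqVneq (u y) 0; first by rewrite !mul0r.
  (* The [E i] are known to be a basis at [x] only, hence the basis [B] at [y]; [N] is invertible as
     a factor of a matrix of determinant [d y]. *)
  have [co coP] := tangent_basis_coord bB.
  pose N := \matrix_(i, j) B i (F j) y.
  have EN : \matrix_(i, j) E i (F j) y = (\matrix_(i < m) co (E i)) *m N.
    by apply/matrixP => i j; rewrite !mxE coP; apply: eq_bigr => l _; rewrite !mxE.
  have uN : N \in unitmx.
    move: dy; rewrite dE EN det_mulmx mulf_eq0 negb_or => /andP[_].
    by rewrite unitmxE unitfE.
  have cY : co Y = 0.
    rewrite -[co Y](mulmxK uN) (_ : co Y *m N = 0) ?mul0mx //.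
    apply/rowP => j; rewrite !mxE; transitivity (Y (F j) y); last by rewrite YF.
    by rewrite coP; apply: eq_bigr => i _; rewrite mxE.
  by rewrite coP cY big1 ?mulr0 // => i _; rewrite mxE mul0r.
rewrite -[theta X]/(th X).
have : th ((u * d) *: Y) x = 0 by rewrite Y0 raddf0.
rewrite linearZ -[LHS]/(u x * d x * th Y x) => /eqP.
have dx : d x != 0 by rewrite dE -unitfE -unitmxE.
rewrite !mulf_eq0 (negbTE ux) (negbTE dx) !orFb => /eqP.
rewrite /Y linearB linearZ linear_sum.
rewrite -[LHS]/(d x * th X x - (\sum_i th (k 0 i *: E i)) x).
have -> : (\sum_i th (k 0 i *: E i)) x = 0.
  rewrite smooth_fun_sum big1 // => i _.
  rewrite linearZ -[LHS]/(k 0 i x * th (E i) x) mxE smooth_fun_sum big1 ?mul0r // => j _.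
  by rewrite [h _ _]mxE -[LHS]/(X (F j) x * _) X0 mul0r.
by rewrite subr0 => /eqP; rewrite mulf_eq0 (negbTE dx) => /eqP.
Qed.
End Evaluation.

(** * Coordinates and traces at a point *)

Section Trace.
Context {R : realType} {m : nat} {M : smooth_manifold R m}.
Implicit Types (f : C^oo(M)) (X Y : X^oo(M)).
Variables (x : M) (E : 'I_m -> X^oo(M)) (co : X^oo(M) -> 'rV[R]_m).
Hypothesis (bE : tangent_basis x E).
Hypothesis (coP : forall X f, X f x = \sum_i co X 0 i * E i f x).
Hypothesis (loc : local_at x).

Lemma frame_coordE X (c : 'rV[R]_m) : (forall f, X f x = \sum_i c 0 i * E i f x) -> co X = c.
Proof. by move=> cP; apply: (tangent_basis_inj bE) => f; rewrite -coP cP. Qed.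

Lemma frame_coordD X Y : co (X + Y) = co X + co Y.
Proof.
apply: frame_coordE => f; rewrite -[LHS]/(X f x + Y f x) !coP -big_split.
by apply: eq_bigr => i _; rewrite mxE mulrDl.
Qed.

Lemma frame_coordZ f X : co (f *: X) = f x *: co X.
Proof.
apply: frame_coordE => h; rewrite -[LHS]/(f x * X h x) coP mulr_sumr.
by apply: eq_bigr => i _; rewrite mxE mulrA.
Qed.

Lemma frame_coordB X Y : co (X - Y) = co X - co Y.
Proof.
by rewrite -scaleN1r frame_coordD frame_coordZ -[(- 1 : C^oo(M)) x]/(-1 : R) scaleN1r.
Qed.

Lemma frame_coord_basis j : co (E j) = delta_mx 0 j.
Proof.
apply: frame_coordE => f; rewrite (bigD1 j) //= !mxE !eqxx mul1r big1 ?addr0 // => i ij.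
by rewrite mxE (negbTE ij) andbF mul0r.
Qed.

Lemma frame_coord_eq X Y : (forall f, X f x = Y f x) -> co X = co Y.
Proof. by move=> XY; apply: frame_coordE => f; rewrite XY coP. Qed.

Lemma linear_local (A : X^oo(M) -> X^oo(M)) X :
  linear A -> vanishes x X -> vanishes x (A X).
Proof.
move=> lA X0 f; apply: (scalar_local (theta := fun Y => A Y f) loc _ X0).
by move=> h Y Z; rewrite lA.
Qed.

(** [X] agrees with the combination of the [B i] at [x] only; constant coefficients make that
    combination a global field, and locality carries the agreement over to the images under [A]. *)
Lemma linear_coord (A : X^oo(M) -> X^oo(M)) X (c : 'rV[R]_m) (B : 'I_m -> X^oo(M)) :
  linear A -> (forall f, X f x = \sum_i c 0 i * B i f x) ->
  co (A X) = \sum_i c 0 i *: co (A (B i)).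
Proof.
move=> lA Xc.
pose Al : {linear X^oo(M) -> X^oo(M)} := HB.pack A
  (GRing.isLinear.Build C^oo(M) X^oo(M) X^oo(M) *:%R A lA).
have V0 : vanishes x (X - \sum_i cst_fun M (c 0 i) *: B i).
  move=> f; rewrite -[LHS]/(X f x - (\sum_i cst_fun M (c 0 i) *: B i) f x).
  by rewrite vfield_sum smooth_fun_sum Xc subrr.
have AV0 := linear_local lA V0.
apply: frame_coordE => f; apply/eqP; rewrite -subr_eq0; apply/eqP.
rewrite -[RHS](AV0 f) -[A (X - _)]/(Al (X - _)) linearB (linear_sum Al).
rewrite -[RHS]/(A X f x - (\sum_i Al (cst_fun M (c 0 i) *: B i)) f x).
rewrite vfield_sum smooth_fun_sum; congr (_ - _).
transitivity (\sum_i c 0 i * A (B i) f x); last first.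
  by apply: eq_bigr => i _; rewrite linearZ.
under [RHS]eq_bigr do rewrite coP mulr_sumr.
rewrite exchange_big /=; apply: eq_bigr => i _.
by rewrite summxE mulr_suml; apply: eq_bigr => j _; rewrite mxE mulrA.
Qed.

(** The left side is the trace at [x] of the rank-one operator [Y |-> theta Y *: X]; such operators
    occur in the Ricci traces below. *)
Lemma scalar_coord (theta : X^oo(M) -> C^oo(M)) X :
  scalar theta -> \sum_j co X 0 j * theta (E j) x = theta X x.
Proof.
move=> lt; pose th : {scalar X^oo(M)} := HB.pack theta
  (GRing.isLinear.Build C^oo(M) X^oo(M) C^oo(M) *%R theta lt).
have V0 : vanishes x (X - \sum_i cst_fun M (co X 0 i) *: E i).
  move=> f; rewrite -[LHS]/(X f x - (\sum_i cst_fun M (co X 0 i) *: E i) f x).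
  by rewrite vfield_sum smooth_fun_sum coP subrr.
have := scalar_local loc lt V0; rewrite -[theta _]/(th _) linearB (linear_sum th).
rewrite -[LHS]/(theta X x - (\sum_i th (cst_fun M (co X 0 i) *: E i)) x) => /eqP.
rewrite subr_eq0 => /eqP ->; rewrite smooth_fun_sum; apply: eq_bigr => i _.
by rewrite linearZ.
Qed.

(** The basis behind [xget] is arbitrary, so independence of the basis is shown: [P] and [Q] are
    mutually inverse changes of basis. The transpose of [a] arises because coordinates are row
    vectors. *)
Lemma trace_fieldE (A : X^oo(M) -> X^oo(M)) :
  linear A -> trace_field A x = \sum_j co (A (E j)) 0 j.
Proof.
move=> lA; rewrite /trace_field; case: xgetP => [t _|noT]; last first.
  case: (noT (\sum_j co (A (E j)) 0 j)).
  exists E, (\matrix_(i, j) co (A (E j)) 0 i); split=> // [j f|].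
    by rewrite coP; apply: eq_bigr => i _; rewrite mxE.
  by apply: eq_bigr => j _; rewrite mxE.
move=> [E' [a [bE' aP ->]]].
have [co' co'P] := tangent_basis_coord bE'.
pose P := \matrix_(j < m) co (E' j); pose B := \matrix_(j < m) co (A (E j)).
pose Q := \matrix_(j < m) co' (E j).
have aPB : a^T *m P = P *m B.
  apply/row_matrixP => j; rewrite !row_mul !mulmx_sum_row.
  transitivity (co (A (E' j))).
    have := @linear_coord id (A (E' j)) (row j a^T) E'.
    rewrite /= => -> //; first by apply: eq_bigr => i _; rewrite rowK.
    by move=> f; rewrite aP; apply: eq_bigr => i _; rewrite !mxE.
  rewrite (linear_coord lA (coP (E' j))); apply: eq_bigr => i _.
  by rewrite !rowK.
have QP : Q *m P = 1%:M.
  apply/row_matrixP => j; rewrite row_mul mulmx_sum_row row1 -frame_coord_basis.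
  have := @linear_coord id (E j) (co' (E j)) E'.
  by rewrite /= => -> //; apply: eq_bigr => i _; rewrite !rowK.
rewrite -mxtrace_tr -[a^T]mulmx1 -(mulmx1C QP) mulmxA aPB -mulmxA mxtrace_mulC.
rewrite -mulmxA QP mulmx1; apply: eq_bigr => j _.
by rewrite -[RHS]/(co (A (E j)) 0 j) mxE.
Qed.

End Trace.

Lemma trace_field_neq0 (R : realType) (m : nat) (M : smooth_manifold R m)
  (A : X^oo(M) -> X^oo(M)) x : trace_field A x != 0 -> has_basis x.
Proof.
rewrite /trace_field; case: xgetP => [t _ [E [a [bE _ _]]] _|]; first by exists E.
by rewrite eqxx.
Qed.

(** * Lie bracket identities and algebra of the metric *)

Section Metric.
Context {R : realType} {m : nat} {M : smooth_manifold R m}.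
Implicit Types (f : C^oo(M)) (X Y Z W : X^oo(M)).

Lemma vfieldN X f : X (- f) = - X f.
Proof. by rewrite -scaleN1r vfieldZ scaleN1r. Qed.

Lemma lie_bracketE X Y f : lie_bracket X Y f = X (Y f) - Y (X f).
Proof. by []. Qed.

Lemma lie_bracketC X Y : lie_bracket X Y = - lie_bracket Y X.
Proof.
by apply/val_inj/funext => f; rewrite -[RHS]/(- (lie_bracket Y X f)) opprB.
Qed.

Lemma jacobi X Y Z : lie_bracket (lie_bracket X Y) Z
  + lie_bracket (lie_bracket Y Z) X + lie_bracket (lie_bracket Z X) Y = 0.
Proof.
apply/val_inj/funext => f /=.
rewrite -[LHS]/(lie_bracket (lie_bracket X Y) Z f
  + lie_bracket (lie_bracket Y Z) X f + lie_bracket (lie_bracket Z X) Y f).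
rewrite !(lie_bracketE, vfieldD, vfieldN) -[RHS]/(0 : C^oo(M)); ring.
Qed.

Lemma lie_bracketZl f X Y :
  lie_bracket (f *: X) Y = f *: lie_bracket X Y - Y f *: X.
Proof.
apply/val_inj/funext => h.
rewrite -[LHS]/(f * X (Y h) - Y (f * X h)) vfieldM.
rewrite -[RHS]/(f * (X (Y h) - Y (X h)) - Y f * X h); ring.
Qed.

Lemma lie_bracketDl X Y Z :
  lie_bracket (X + Y) Z = lie_bracket X Z + lie_bracket Y Z.
Proof.
apply/val_inj/funext => h.
rewrite -[LHS]/(X (Z h) + Y (Z h) - Z (X h + Y h)) vfieldD.
rewrite -[RHS]/(X (Z h) - Z (X h) + (Y (Z h) - Z (Y h))); ring.
Qed.

Variable g : X^oo(M) -> X^oo(M) -> C^oo(M).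
Hypothesis hg : riemannian_metric g.

Lemma metricDl X Y Z : g (X + Y) Z = g X Z + g Y Z.
Proof. by have := metric_linear hg 1 X Y Z; rewrite scale1r mul1r. Qed.

Lemma metric0l Z : g 0 Z = 0.
Proof. by apply: (addrI (g 0 Z)); rewrite -metricDl !addr0. Qed.

Lemma metricZl f X Z : g (f *: X) Z = f * g X Z.
Proof. by have := metric_linear hg f X 0 Z; rewrite metric0l !addr0. Qed.

Lemma metricNl X Z : g (- X) Z = - g X Z.
Proof. by rewrite -scaleN1r metricZl mulN1r. Qed.

Lemma metricBl X Y Z : g (X - Y) Z = g X Z - g Y Z.
Proof. by rewrite metricDl metricNl. Qed.

Lemma metricDr X Y Z : g Z (X + Y) = g Z X + g Z Y.
Proof. by rewrite !(Defs.metric_sym hg Z) metricDl. Qed.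

Lemma metricZr f X Z : g Z (f *: X) = f * g Z X.
Proof. by rewrite !(Defs.metric_sym hg Z) metricZl. Qed.

Lemma metricNr X Z : g Z (- X) = - g Z X.
Proof. by rewrite !(Defs.metric_sym hg Z) metricNl. Qed.

Lemma metric0r Z : g Z 0 = 0.
Proof. by rewrite (Defs.metric_sym hg) metric0l. Qed.

Lemma metric_vanishes x X : g X X x = 0 -> vanishes x X.
Proof.
move=> X0 f; apply: contrapT => /eqP Xf.
by have := metric_pos hg (ex_intro _ f Xf); rewrite X0 ltxx.
Qed.

(** Positivity with [W = X - Y]. It reduces identities between vector fields to identities between
    functions. *)
Lemma metric_inj X Y : (forall W, g X W = g Y W) -> X = Y.
Proof.
move=> gXY; apply/eqP; rewrite -subr_eq0; apply/eqP/vfield_ext => f x.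
by apply: metric_vanishes; rewrite metricBl gXY subrr.
Qed.

End Metric.

(** * Symmetries of the Levi-Civita curvature *)

Section LeviCivita.
Context {R : realType} {m : nat} {M : smooth_manifold R m}.
Implicit Types (f : C^oo(M)) (X Y Z W : X^oo(M)).
Variables (g : X^oo(M) -> X^oo(M) -> C^oo(M)).
Variables (nabla : X^oo(M) -> X^oo(M) -> X^oo(M)).
Hypotheses (hg : riemannian_metric g) (hn : levi_civita g nabla).

Local Notation curv := (curvature nabla).

Lemma nablaDl X Y Z : nabla (X + Y) Z = nabla X Z + nabla Y Z.
Proof. by have := nabla_linear hn 1 X Y Z; rewrite !scale1r. Qed.

Lemma nabla0l Z : nabla 0 Z = 0.
Proof. by apply: (addrI (nabla 0 Z)); rewrite -nablaDl !addr0. Qed.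

Lemma nablaZl f X Z : nabla (f *: X) Z = f *: nabla X Z.
Proof. by have := nabla_linear hn f X 0 Z; rewrite nabla0l !addr0. Qed.

Lemma nablaNl X Z : nabla (- X) Z = - nabla X Z.
Proof. by rewrite -scaleN1r nablaZl scaleN1r. Qed.

Lemma nabla0r X : nabla X 0 = 0.
Proof. by apply: (addrI (nabla X 0)); rewrite -(nablaD hn) !addr0. Qed.

Lemma nablaNr X Z : nabla X (- Z) = - nabla X Z.
Proof. by apply: (addrI (nabla X Z)); rewrite -(nablaD hn) !subrr nabla0r. Qed.

Lemma metric_bracket X Y Z :
  g (lie_bracket X Y) Z = g (nabla X Y) Z - g (nabla Y X) Z.
Proof. by rewrite -(nabla_torsion_free hn) metricBl. Qed.

Lemma metric_curvature X Y Z W : g (curv X Y Z) W =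
  g (nabla X (nabla Y Z)) W - g (nabla Y (nabla X Z)) W
  - g (nabla (lie_bracket X Y) Z) W.
Proof. by rewrite /curvature !metricBl. Qed.

Lemma curvatureC X Y Z : curv X Y Z = - curv Y X Z.
Proof.
apply: (metric_inj hg) => W; rewrite metricNl // !metric_curvature.
rewrite (lie_bracketC X Y) nablaNl metricNl //; ring.
Qed.

Lemma curvature_linear Y Z : linear (fun X => curv X Y Z).
Proof.
move=> f X X'; apply: (metric_inj hg) => W.
rewrite [RHS](metricDl hg) [g (f *: _) W](metricZl hg) !metric_curvature.
rewrite lie_bracketDl lie_bracketZl.
rewrite !(nablaDl, nablaZl, nablaNl, nablaD hn, nabla_leibniz hn).
rewrite !(metricDl hg, metricZl hg, metricNl hg); ring.
Qed.

(** By torsion-freeness, paired second derivatives together with a bracket term form a double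
    bracket; the three of them cancel by the Jacobi identity. *)
Lemma bianchi X Y Z W :
  g (curv X Y Z) W + g (curv Y Z X) W + g (curv Z X Y) W = 0.
Proof.
have H A B C : g (nabla A (nabla B C)) W - g (nabla A (nabla C B)) W
    - g (nabla (lie_bracket B C) A) W = - g (lie_bracket (lie_bracket B C) A) W.
  rewrite -metricBl // -nablaNr -(nablaD hn) (nabla_torsion_free hn).
  by rewrite -(nabla_torsion_free hn (lie_bracket B C)) metricBl // opprB.
have J := congr1 (g^~ W) (jacobi X Y Z).
rewrite !(metricDl hg) (metric0l hg) in J; rewrite !metric_curvature.
apply: smooth_fun_ext => x.
have /(congr1 (evalf x)) := J; have /(congr1 (evalf x)) := H X Y Z.
have /(congr1 (evalf x)) := H Y Z X; have /(congr1 (evalf x)) := H Z X Y.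
rewrite /evalf !smooth_funE -[(0 : C^oo(M)) x]/(0 : R); lra.
Qed.

(** Metric compatibility expands the derivative of [g Z W] along [lie_bracket X Y] both directly and
    as a commutator. *)
Lemma curvature_skew X Y Z W : g (curv X Y Z) W = - g (curv X Y W) Z.
Proof.
apply/eqP; rewrite -subr_eq0 opprK; apply/eqP.
have := lie_bracketE X Y (g Z W); rewrite !(nabla_metric hn) !vfieldD !(nabla_metric hn).
rewrite !metric_curvature !(Defs.metric_sym hg Z) !(Defs.metric_sym hg (nabla _ Z)) => /eqP.
rewrite -subr_eq0 => /eqP e; rewrite -[RHS]oppr0 -e; ring.
Qed.

(** The Bianchi identities for the four cyclic shifts of the arguments, reduced by the two
    skew-symmetries, combine linearly; [lra] finds the combination at each point. *)
Lemma curvature_pair X Y Z W : g (curv X Y Z) W = g (curv Z W X) Y.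
Proof.
apply: smooth_fun_ext => x.
have hB V1 V2 V3 V4 : g (curv V1 V2 V3) V4 x + g (curv V2 V3 V1) V4 x + g (curv V3 V1 V2) V4 x = 0.
  by have /(congr1 (fun f : C^oo(M) => f x)) := bianchi V1 V2 V3 V4.
have hS V1 V2 V3 V4 : g (curv V1 V2 V3) V4 x = - g (curv V1 V2 V4) V3 x.
  by rewrite curvature_skew.
have hC V1 V2 V3 V4 : g (curv V1 V2 V3) V4 x = - g (curv V2 V1 V3) V4 x.
  by rewrite curvatureC metricNl.
have := hB X Y Z W; have := hB Y Z W X; have := hB Z W X Y; have := hB W X Y Z.
have := hS X Y Z W; have := hS Z W X Y; have := hS Y Z X W; have := hS Z X Y W.
have := hS Y Z W X; have := hS W Y Z X; have := hS Z W Y X; have := hS W X Z Y.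
have := hS X Z W Y; have := hS W X Y Z; have := hS X Y W Z; have := hS Y W X Z.
have := hC X Y Z W; have := hC Z W X Y; have := hC Y Z X W; have := hC Z X Y W.
have := hC X W Z Y; have := hC Y W X Z; have := hC Y W Z X; have := hC W X Y Z.
have := hC X Z Y W; have := hC X Z W Y.
lra.
Qed.

End LeviCivita.

(** * Sasakian identities for the derivatives of [phi] and [xi] and for the curvature *)

Section Sasakian.
Context {R : realType} {n : nat} {M : smooth_manifold R (2 * n).+1}.
Implicit Types (f : C^oo(M)) (X Y Z W : X^oo(M)).
Variables (phi : {linear X^oo(M) -> X^oo(M)}) (xi : X^oo(M)).
Variables (eta : {scalar X^oo(M)}) (g : X^oo(M) -> X^oo(M) -> C^oo(M)).
Variable nabla : X^oo(M) -> X^oo(M) -> X^oo(M).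
Hypothesis hacm : almost_contact_metric phi xi eta g.
Hypothesis hcontact : forall X Y, ext_derivative eta X Y = g X (phi Y).
Hypothesis hnormal : normal_structure phi xi eta.
Hypothesis hn : levi_civita g nabla.

Local Notation curv := (curvature nabla).

Let hg : riemannian_metric g := acm_metric hacm.

Let metricE := (metricDl hg, metricZl hg, metricNl hg,
  metricDr hg, metricZr hg, metricNr hg).

Lemma vfield1 X : X 1 = 0.
Proof. by apply: (addrI (X 1)); rewrite addr0 -{3}[1]mulr1 vfieldM mulr1 mul1r. Qed.

(** Up to a constant factor this is [d (d eta) = 0]: after expansion only [eta] of the Jacobi
    identity remains. *)
Lemma contact_closed X Y Z :
  X (g Y (phi Z)) + Y (g Z (phi X)) + Z (g X (phi Y))
  - (g (lie_bracket X Y) (phi Z) + g (lie_bracket Y Z) (phi X)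
     + g (lie_bracket Z X) (phi Y)) = 0.
Proof.
rewrite -!hcontact /ext_derivative !vfieldZ -!scalerDr -scalerBr.
apply/eqP; rewrite scaler_eq0; apply/orP; right; apply/eqP.
have J := congr1 eta (jacobi X Y Z); rewrite !raddfD raddf0 in J.
rewrite !(vfieldD, vfieldN) !lie_bracketE -[RHS]J; ring.
Qed.

(* [g ((nabla_X phi) Y) Z], written with the skew-symmetry of [phi] *)
Definition nabla_phi X Y Z : C^oo(M) :=
  g (nabla X (phi Y)) Z + g (nabla X Y) (phi Z).

Lemma nabla_phi_skew X Y Z : nabla_phi X Y Z = - nabla_phi X Z Y.
Proof.
have := nabla_metric hn X (phi Y) Z; have := nabla_metric hn X Y (phi Z).
rewrite (acm_skew hacm) vfieldN /nabla_phi => e1 e2.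
rewrite !(Defs.metric_sym hg (nabla X Z)) !(Defs.metric_sym hg (nabla X (phi Z))).
apply: smooth_fun_ext => x.
have /(congr1 (evalf x)) := e1; have /(congr1 (evalf x)) := e2.
rewrite /evalf !(smooth_fun0, smooth_funE); lra.
Qed.

Lemma nabla_phi_cyclic X Y Z :
  nabla_phi X Y Z + nabla_phi Y Z X + nabla_phi Z X Y = 0.
Proof.
have := contact_closed X Z Y; rewrite !(nabla_metric hn) !(metric_bracket hg hn).
rewrite /nabla_phi => e.
rewrite -[RHS]e !(Defs.metric_sym hg _ (nabla _ (phi _))); ring.
Qed.

(** Normality paired with [Z], its brackets replaced by covariant derivatives. *)
Lemma nabla_phi_normal X Y Z :
  nabla_phi (phi X) Y Z - nabla_phi (phi Y) X Z
  + nabla_phi X Y (phi Z) - nabla_phi Y X (phi Z) = - (g X (phi Y) *+ 2 * eta Z).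
Proof.
have := congr1 (g^~ Z) (hnormal X Y); rewrite /nijenhuis hcontact /=.
rewrite (metric0l hg) !metricE.
have sk V W : g (phi V) W = - g V (phi W) by rewrite (acm_skew hacm) opprK.
rewrite !sk opprK !(metric_bracket hg hn) -!(acm_dual hacm).
rewrite (Defs.metric_sym hg xi) /nabla_phi => e.
apply/eqP; rewrite -addr_eq0 -[0]e; apply/eqP; ring.
Qed.

(** As [phi xi = 0], [d eta (xi, W)] vanishes; expanded, it leaves [g (nabla xi xi) W], since
    [g xi xi = 1] kills [g (nabla W xi) xi]. *)
Lemma nabla_xi_xi : nabla xi xi = 0.
Proof.
apply: (metric_inj hg) => W; rewrite (metric0l hg); apply: smooth_fun_ext => x.
have := hcontact xi W; rewrite /ext_derivative.
rewrite (acm_skew hacm) (acm_phi_xi hacm) (metric0l hg) (acm_eta_xi hacm) oppr0.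
rewrite -!(acm_dual hacm) (nabla_metric hn) (metric_bracket hg hn).
have := nabla_metric hn W xi xi; rewrite (acm_dual hacm) (acm_eta_xi hacm).
rewrite vfield1 (Defs.metric_sym hg xi (nabla _ _)) => e0.
rewrite (Defs.metric_sym hg W) => e1.
have /(congr1 (evalf x)) := e1; have /(congr1 (evalf x)) := e0.
rewrite /evalf !smooth_funE -[(0 : C^oo(M)) x]/(0 : R); lra.
Qed.

(** The classical [(nabla_X phi) Y = g X Y *: xi - eta Y *: X]. Normality, cyclicity and
    skew-symmetry determine it linearly for [X] in the image of [phi]; the case [X = xi] is treated
    apart, and [decomp] joins the two. *)
Lemma nabla_phiE X Y Z :
  nabla_phi X Y Z = g X Y * eta Z - g X Z * eta Y.
Proof.
have phiE A B C : nabla_phi (phi A) B C = g (phi A) B * eta C - g (phi A) C * eta B.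
  apply: smooth_fun_ext => x.
  have /(congr1 (evalf x)) := nabla_phi_normal B A C.
  have /(congr1 (evalf x)) := nabla_phi_normal A C B.
  have /(congr1 (evalf x)) := nabla_phi_cyclic B A (phi C).
  have /(congr1 (evalf x)) := nabla_phi_cyclic A C (phi B).
  have /(congr1 (evalf x)) := nabla_phi_skew A (phi C) B.
  have /(congr1 (evalf x)) := nabla_phi_skew (phi C) B A.
  have /(congr1 (evalf x)) := nabla_phi_skew (phi B) A C.
  have /(congr1 (evalf x)) := nabla_phi_skew C (phi B) A.
  have /(congr1 (evalf x)) := nabla_phi_skew A B (phi C).
  have /(congr1 (evalf x)) := nabla_phi_skew (phi A) B C.
  have /(congr1 (evalf x)) := nabla_phi_skew B A (phi C).
  rewrite (Defs.metric_sym hg B (phi A)) (acm_skew hacm A C) !mulr2n.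
  rewrite /evalf !(smooth_fun0, smooth_funE). lra.
have lin f A B C D : nabla_phi (f *: A + B) C D = f * nabla_phi A C D + nabla_phi B C D.
  by rewrite /nabla_phi !(nabla_linear hn) !(metric_linear hg); ring.
have xi0 C : nabla_phi xi C xi = 0.
  rewrite /nabla_phi (acm_phi_xi hacm) (metric0r hg) addr0.
  have := nabla_metric hn xi (phi C) xi.
  rewrite nabla_xi_xi (metric0r hg) (acm_dual hacm) (acm_eta_phi hacm) vfield0 addr0.
  by move=> <-.
have decomp A : A = eta A *: xi + phi (- phi A).
  by rewrite linearN (acm_phi2 hacm) opprD opprK addrCA subrr addr0.
have hor B C : nabla_phi B C xi = g B C - eta B * eta C.
  rewrite {1}(decomp B) lin phiE xi0 !(acm_dual hacm) (acm_eta_xi hacm) (acm_eta_phi hacm).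
  rewrite linearN (acm_phi2 hacm) !metricE (Defs.metric_sym hg xi) (acm_dual hacm); ring.
(* The other two terms of the cyclic sum are given by [hor] up to sign, and cancel because [hor] is
   symmetric in [B] and [C]. *)
have xiE B C : nabla_phi xi B C = 0.
  have := nabla_phi_cyclic xi B C; rewrite (nabla_phi_skew C xi B) !hor.
  by rewrite (Defs.metric_sym hg C) => e; rewrite -[RHS]e; ring.
rewrite {1}(decomp X) lin xiE mulr0 add0r phiE linearN.
by rewrite (acm_phi2 hacm) !metricE !(Defs.metric_sym hg xi) !(acm_dual hacm); ring.
Qed.

(** [nabla_phiE] applied to [xi] and [phi W] gives the part orthogonal to [xi]; the part along [xi]
    vanishes because [g xi xi = 1]. *)
Lemma nabla_xi X : nabla X xi = - phi X.
Proof.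
have gxi V : g xi V = eta V by rewrite (Defs.metric_sym hg) (acm_dual hacm).
apply: (metric_inj hg) => W; rewrite metricE; apply: smooth_fun_ext => x.
have := nabla_phiE X xi (phi W); rewrite /nabla_phi (acm_phi_xi hacm) (nabla0r hn).
rewrite (metric0l hg) (acm_eta_phi hacm) (acm_eta_xi hacm) (acm_phi2 hacm) !metricE.
rewrite (acm_skew hacm) => /(congr1 (evalf x)) e1.
have := nabla_metric hn X xi xi; rewrite (acm_dual hacm xi) (acm_eta_xi hacm) vfield1.
rewrite (Defs.metric_sym hg xi) => /(congr1 (evalf x)) e2.
have e3 : g (nabla X xi) xi x = 0.
  by move: e2; rewrite /evalf !(smooth_fun0, smooth_funE); lra.
move: e1; rewrite /evalf !(smooth_fun0, smooth_funE) e3; lra.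
Qed.

(** By [nabla_xi], the curvature on [xi] is the antisymmetrised derivative of [phi], known from
    [nabla_phiE]. *)
Lemma curvature_xi X Y : curv X Y xi = eta Y *: X - eta X *: Y.
Proof.
apply: (metric_inj hg) => W; rewrite (metric_curvature nabla hg) !nabla_xi.
rewrite !(nablaNr hn) !metricE.
have sk V : g (phi V) W = - g V (phi W) by rewrite (acm_skew hacm) opprK.
rewrite sk (metric_bracket hg hn).
have := nabla_phiE X Y W; have := nabla_phiE Y X W; rewrite /nabla_phi.
rewrite (Defs.metric_sym hg Y X) => e1 e2; apply: smooth_fun_ext => x.
have /(congr1 (evalf x)) := e1; have /(congr1 (evalf x)) := e2.
rewrite /evalf !(smooth_fun0, smooth_funE); lra.
Qed.

Lemma curvature_xil Y Z : curv xi Y Z = g Y Z *: xi - eta Z *: Y.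
Proof.
apply: (metric_inj hg) => W.
rewrite (curvature_pair hg hn) curvature_xi !metricE (Defs.metric_sym hg xi).
by rewrite (acm_dual hacm) (Defs.metric_sym hg W) (Defs.metric_sym hg Z); ring.
Qed.

Lemma eta_curvature X Y Z : eta (curv X Y Z) = eta X * g Y Z - eta Y * g X Z.
Proof.
rewrite -(acm_dual hacm (curv X Y Z)) (curvature_skew hg hn) curvature_xi.
by rewrite !metricE; ring.
Qed.

End Sasakian.

(** * The Ricci tensor under [phi]-projective flatness *)

Section Ricci.
Context {R : realType} {n : nat} {M : smooth_manifold R (2 * n).+1}.
Implicit Types (f : C^oo(M)) (X Y Z W : X^oo(M)).
Variables (phi : {linear X^oo(M) -> X^oo(M)}) (xi : X^oo(M)).
Variables (eta : {scalar X^oo(M)}) (g : X^oo(M) -> X^oo(M) -> C^oo(M)).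
Variables (nabla : X^oo(M) -> X^oo(M) -> X^oo(M)) (Q : X^oo(M) -> X^oo(M)).
Hypothesis hacm : almost_contact_metric phi xi eta g.
Hypothesis hcontact : forall X Y, ext_derivative eta X Y = g X (phi Y).
Hypothesis hnormal : normal_structure phi xi eta.
Hypothesis hn : levi_civita g nabla.
Hypothesis hQ : ricci_operator g nabla Q.
Hypothesis hflat : forall X Y Z,
  phi (phi (projective_curvature g nabla Q (phi X) (phi Y) (phi Z))) = 0.
Hypothesis n_gt0 : (0 < n)%N.

Local Notation curv := (curvature nabla).
Local Notation ric := (ricci nabla).

Let hg : riemannian_metric g := acm_metric hacm.

Let metricE := (metricDl hg, metricZl hg, metricNl hg,
  metricDr hg, metricZr hg, metricNr hg).

Let hor X : X^oo(M) := X - eta X *: xi.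

(** Exhibits horizontal vectors as values of [phi], the form in which flatness applies. *)
Lemma horE X : hor X = phi (- phi X).
Proof. by rewrite linearN (acm_phi2 hacm) opprD opprK. Qed.

Lemma hor_decomp X : X = eta X *: xi + hor X.
Proof. by rewrite addrCA subrr addr0. Qed.

Lemma metric_horl X Y : g (hor X) Y = g X Y - eta X * eta Y.
Proof. by rewrite !metricE (Defs.metric_sym hg xi) (acm_dual hacm). Qed.

Lemma metric_horr X Y : g X (hor Y) = g X Y - eta X * eta Y.
Proof. by rewrite !metricE (acm_dual hacm) (mulrC (eta Y)). Qed.

Lemma eta_hor X : eta (hor X) = 0.
Proof. by rewrite horE (acm_eta_phi hacm). Qed.

(** The [xi] part of [X] gives the last term. On its horizontal part, flatness fixes the curvature
    up to a multiple of [xi], which [eta_curvature] shows to be zero. *)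
Lemma flat_curvature X Y Z : curv X (phi Y) (phi Z) =
  cst_fun M (2 * n)%:R^-1 *: (g (phi Y) (phi Z) *: hor (Q (hor X))
                              - g X (phi Z) *: hor (Q (phi Y)))
  + (eta X * g (phi Y) (phi Z)) *: xi.
Proof.
rewrite {1}(hor_decomp X) (curvature_linear hg hn) addrC; congr (_ + _); last first.
  by rewrite (curvature_xil hacm hcontact hnormal hn) (acm_eta_phi hacm) scale0r subr0 scalerA.
have V0 : eta (curv (hor X) (phi Y) (phi Z)) = 0.
  rewrite (eta_curvature hacm hcontact hnormal hn) eta_hor (acm_eta_phi hacm).
  by rewrite !mul0r subrr.
have h2 V : phi (phi V) = - hor V by rewrite (acm_phi2 hacm) opprB addrC.
have := hflat (- phi X) Y Z; rewrite -horE /projective_curvature.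
have -> : g (hor X) (phi Z) = g X (phi Z).
  by rewrite metric_horl (acm_eta_phi hacm) mulr0 subr0.
have pB V W : phi (V - W) = phi V - phi W by rewrite linearB.
have pZ f V : phi (f *: V) = f *: phi V by rewrite linearZ.
move: (curv _ _ _) V0 => C C0; rewrite !(pB, pZ) !h2 => /eqP; rewrite subr_eq0 => /eqP e.
rewrite -[LHS]subr0 -(scale0r xi) -C0 -[LHS]/(hor _) -[LHS]opprK e.
by rewrite -scalerN opprB !scalerN opprK addrC.
Qed.

Section AtPoint.
Variables (x : M) (loc : local_at x).

Lemma ricci_local_linear f X Y Z :
  ric (f *: X + Y) Z x = f x * ric X Z x + ric Y Z x.
Proof.
have [[E bE] _] := loc; have [co coP] := tangent_basis_coord bE.
rewrite /ricci !(trace_fieldE bE coP loc (curvature_linear hg hn _ _)).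
rewrite mulr_sumr -big_split; apply: eq_bigr => j _ /=.
rewrite !(curvatureC hg hn (E j)) (curvature_linear hg hn) -[- (_ + _)]scaleN1r.
rewrite scalerDr !scaleN1r -scalerN (frame_coordD bE coP) (frame_coordZ bE coP).
by rewrite [LHS]mxE [X in X + _]mxE.
Qed.

(** The operator is [eta Y] times the identity minus a rank-one map of trace [eta Y]; in dimension
    [2 * n + 1] this leaves the factor [2 * n]. *)
Lemma ricci_local_xir Y : ric Y xi x = (2 * n)%:R * eta Y x.
Proof.
have [[E bE] _] := loc; have [co coP] := tangent_basis_coord bE.
rewrite /ricci (trace_fieldE bE coP loc (curvature_linear hg hn _ _)).
under eq_bigr => j _.
  rewrite (curvature_xi hacm hcontact hnormal hn) (frame_coordB bE coP) !(frame_coordZ bE coP).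
  rewrite (frame_coord_basis bE coP) !mxE !eqxx mulr1 (mulrC (eta (E j) x)).
  over.
rewrite sumrB sumr_const card_ord (scalar_coord coP loc Y (linearP eta)).
by rewrite mulrSr addrK mulr_natl.
Qed.

Lemma ricci_local_xil Z : ric xi Z x = (2 * n)%:R * eta Z x.
Proof.
have [[E bE] _] := loc; have [co coP] := tangent_basis_coord bE.
rewrite /ricci (trace_fieldE bE coP loc (curvature_linear hg hn _ _)).
under eq_bigr => j _.
  rewrite (curvatureC hg hn) (curvature_xil hacm hcontact hnormal hn) opprB.
  rewrite (frame_coordB bE coP) !(frame_coordZ bE coP) (frame_coord_basis bE coP) !mxE !eqxx mulr1.
  rewrite (mulrC (g _ _ _)).
  over.
have lin : scalar (g^~ Z) by move=> f X Y; rewrite (metric_linear hg).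
rewrite sumrB sumr_const card_ord (scalar_coord coP loc xi lin).
by rewrite (Defs.metric_sym hg xi) (acm_dual hacm) mulrSr addrK mulr_natl.
Qed.

(** Tracing [flat_curvature] gives proportionality to [g] with a factor [k] depending on the trace
    [rho]; tracing that proportionality gives a second relation between [rho] and [k], and the two
    force [k = 2 * n]. *)
Lemma ricci_local_phi Y Z :
  ric (phi Y) (phi Z) x = (2 * n)%:R * g (phi Y) (phi Z) x.
Proof.
have [[E bE] _] := loc; have [co coP] := tangent_basis_coord bE.
have n0 : (2 * n)%:R != 0 :> R by rewrite pnatr_eq0 muln_eq0 -lt0n.
have n1 : (2 * n)%:R + 1 != 0 :> R by rewrite natr1 pnatr_eq0.
pose rho := \sum_j co (hor (Q (hor (E j)))) 0 j.
(* Solves [r = (s * rho - r) / (2 * n) + s] as [r = k * s], for [r] the Ricci value and [s] the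
   metric value. *)
pose k := (rho + (2 * n)%:R) / ((2 * n)%:R + 1).
have kP A B : ric (phi A) (phi B) x = k * g (phi A) (phi B) x.
  have : ric (phi A) (phi B) x = (2 * n)%:R^-1 * (g (phi A) (phi B) x * rho
      - ric (phi A) (phi B) x) + g (phi A) (phi B) x.
    have lin : scalar (g^~ (phi B)) by move=> f X W; rewrite (metric_linear hg).
    have qE : g (hor (Q (phi A))) (phi B) x = ric (phi A) (phi B) x.
      by rewrite metric_horl (acm_eta_phi hacm) mulr0 subr0 hQ.
    have gE := scalar_coord coP loc (hor (Q (phi A))) lin; rewrite qE in gE.
    have eE := scalar_coord coP loc xi (linearP eta); rewrite (acm_eta_xi hacm) smooth_fun1 in eE.
    rewrite {1}/ricci (trace_fieldE bE coP loc (curvature_linear hg hn _ _)).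
    rewrite -gE -[X in _ + X]mul1r -[in X in _ + X]eE /rho.
    rewrite mulr_sumr -sumrB mulr_sumr mulr_suml -big_split; apply: eq_bigr => j _ /=.
    rewrite flat_curvature (frame_coordD bE coP) !(frame_coordZ bE coP).
    rewrite (frame_coordB bE coP) !(frame_coordZ bE coP) !mxE smooth_funM.
    rewrite -[cst_fun _ _ x]/((2 * n)%:R^-1); ring.
  move: (ric _ _ _) (g _ _ _) => r s e; apply: (mulfI n1).
  have Nr : (2 * n)%:R * r = s * rho - r + (2 * n)%:R * s by rewrite {1}e mulrDr mulVKf.
  rewrite mulrDl mul1r Nr mulrA mulrCA divff // mulr1; ring.
(* At [x], [hor] after [Q] after [hor] is [k] times [hor], whose trace is [2 * n]: the dimension
   minus one for [xi]. *)
have rhoE : rho = k * (2 * n)%:R.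
  have eE := scalar_coord coP loc xi (linearP eta); rewrite (acm_eta_xi hacm) smooth_fun1 in eE.
  transitivity (\sum_j k * (1 - co xi 0 j * eta (E j) x)); last first.
    rewrite -mulr_sumr sumrB eE sumr_const card_ord mulrSr.
    by rewrite addrK.
  apply: eq_bigr => j _.
  have V0 : vanishes x (hor (Q (hor (E j))) - cst_fun M k *: hor (E j)).
    apply: (metric_vanishes hg); set V := _ - _.
    suff gV W : g V W x = 0 by [].
    (* As [hor] is self-adjoint, pairing [V] with [W] involves the Ricci tensor on horizontal
       vectors only, where [kP] applies. *)
    rewrite /V metricBl // metricZl // metric_horl -metric_horr.
    have := kP (- phi (E j)) (- phi W); rewrite -!horE hQ.
    rewrite (metric_horr (hor _)) eta_hor mul0r subr0.
    move=> e; rewrite -[LHS]/(g (Q (hor (E j))) (hor W) x - k * g (hor (E j)) W x).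
    by rewrite e subrr.
  have -> : co (hor (Q (hor (E j)))) = co (cst_fun M k *: hor (E j)).
    apply: (frame_coord_eq bE coP) => f; apply/eqP; rewrite -subr_eq0; apply/eqP.
    exact: V0.
  rewrite (frame_coordZ bE coP) (frame_coordB bE coP) (frame_coordZ bE coP).
  by rewrite (frame_coord_basis bE coP) !mxE !eqxx (mulrC (eta _ _)).
have kE : k = (2 * n)%:R.
  have : ((2 * n)%:R + 1) * k = k * (2 * n)%:R + (2 * n)%:R.
    by rewrite -rhoE mulrCA divff // mulr1.
  lra.
by rewrite kP kE.
Qed.

(** Both arguments are split along [xi] and [ker eta]: linearity in the second comes from [hQ], in
    the first from [ricci_local_linear]. *)
Lemma ricci_local X Y : ric X Y x = (2 * n)%:R * g X Y x.
Proof.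
have split V W : ric V W x = ric V (hor W) x + eta W x * ric V xi x.
  by rewrite !hQ {1}(hor_decomp W) !metricE !smooth_funE addrC.
have splitl V W : ric V W x = eta V x * ric xi W x + ric (hor V) W x.
  by rewrite {1}(hor_decomp V) ricci_local_linear.
have hh V W : ric (hor V) (hor W) x = (2 * n)%:R * g (hor V) (hor W) x.
  by rewrite !horE ricci_local_phi.
rewrite split splitl hh ricci_local_xil ricci_local_xir eta_hor metric_horl.
rewrite metric_horr eta_hor !(smooth_fun0, smooth_funE); ring.
Qed.

End AtPoint.
End Ricci.

Theorem corollary4p11 (R : realType) (n : nat)
  (M : smooth_manifold R (2 * n).+1)
  (phi : {linear X^oo(M) -> X^oo(M)}) (xi : X^oo(M)) (eta : {scalar X^oo(M)})
  (g : X^oo(M) -> X^oo(M) -> C^oo(M))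
  (nabla : X^oo(M) -> X^oo(M) -> X^oo(M)) (Q : X^oo(M) -> X^oo(M))
  (hsasakian : sasakian phi xi eta g)
  (hnabla : levi_civita g nabla)
  (hQ : ricci_operator g nabla Q)
  (hflat : phi_projectively_flat phi g nabla Q)
  (hsoliton : exists (lambda mu : R) (p : C^oo(M)),
     star_conformal_eta_ricci_soliton phi xi eta g nabla lambda mu p) :
  einstein g nabla.
Proof.
have [n_gt0 connM [hacm hcontact] hnormal] := hsasakian; have [_ hP] := hflat.
have loc X Y x : ricci nabla X Y x != 0 -> local_at x.
  move=> Sx; split; first exact: trace_field_neq0 Sx.
  exists (g (Q X) Y) => [|y]; rewrite -hQ //; exact: trace_field_neq0.
have S2n x : local_at x -> forall X Y, ricci nabla X Y x = (2 * n)%:R * g X Y x.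
  exact: (ricci_local hacm hcontact hnormal hnabla hQ hP n_gt0).
have [S0|] := pselect (forall X Y x, ricci nabla X Y x = 0).
  by exists 0 => X Y x; rewrite S0 mul0r.
move=> /existsNP[X0 /existsNP[Y0 /existsNP[x0 /eqP/loc x0loc]]].
have n2_gt0 : 0 < (2 * n)%:R :> R by rewrite ltr0n muln_gt0.
pose s := g (Q xi) xi.
have sloc x : local_at x -> s x = (2 * n)%:R.
  move=> xloc; rewrite -hQ S2n // (acm_dual hacm) (acm_eta_xi hacm).
  by rewrite smooth_fun1 mulr1.
have sval x : 0 < s x -> s x = (2 * n)%:R.
  by move=> sx; apply/sloc/(loc xi xi); rewrite hQ gt_eqF.
(* Continuity of [s] makes the set open. It is also closed: by the gap in [sval], positivity amounts
   to [2 * n <= s x]. *)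
have sT : [set x | 0 < s x] = [set: M].
  apply: connM; first by exists x0; rewrite /= sloc.
  - exists [set x | 0 < s x]; last by rewrite setTI.
    apply: (open_comp (f := s) (D := [set r | 0 < r])) => [x _|]; last exact: open_gt.
    exact: smooth_fun_continuous.
  - exists [set x | (2 * n)%:R <= s x].
      apply: (closed_comp (f := s) (D := [set r | (2 * n)%:R <= r])) => [x _|].
        exact: smooth_fun_continuous.
      exact: closed_ge.
    rewrite setTI; apply/seteqP; split=> x /=; first by move=> /sval ->.
    exact: lt_le_trans.
exists (2 * n)%:R => X Y x; apply: S2n; apply: (loc xi xi).
have : [set y | 0 < s y] x by rewrite sT.
by rewrite hQ => /gt_eqF ->.
Qed.
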